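(* There exists an infinitely generated discrete subgroup $\Gamma<\mathrm{Isom}(\mathbb{H}^{2})$ such that the Hausdorff dimension of its nonconical limit set is zero: $\dim \Lambda_{nc}(\Gamma)=0$.
   Context: For a discrete subgroup $\Gamma<\mathrm{Isom}(\mathbb{H}^n)$, the limit set $\Lambda(\Gamma)\subset S^{n-1}=\partial_\infty\mathbb{H}^n$ is the accumulation set of a $\Gamma$-orbit. A limit point $\xi\in\Lambda(\Gamma)$ is nonconical if for some (equivalently every) $x\in\mathbb{H}^n$ the projection of the geodesic ray from $x$ to $\xi$ to the quotient $\mathbb{H}^n/\Gamma$ is a proper map (eventually leaves every compact set); $\Lambda_{nc}(\Gamma)$ denotes the set of nonconical limit points. Hausdorff dimension is taken with respect to the standard (angular/spherical) metric on the ideal boundary circle. *)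

(* Defs.v *)
From Stdlib Require Import Reals List.
From Coquelicot Require Import Coquelicot.
Open Scope R_scope.

(** Points of the plane; H^2 is the Poincare disk model
    {p | |p| < 1}, its ideal boundary S^1 = {p | |p| = 1}. *)
Definition pt := (R * R)%type.
Definition origin : pt := (0, 0).
Definition nrm2 (p : pt) : R := fst p * fst p + snd p * snd p.
Definition eucl_dist (p q : pt) : R :=
  sqrt ((fst p - fst q) ^ 2 + (snd p - snd q) ^ 2).
Definition in_disk (p : pt) : Prop := nrm2 p < 1.
Definition on_circle (p : pt) : Prop := nrm2 p = 1.
Definition scal (t : R) (p : pt) : pt := (t * fst p, t * snd p).

Definition arcosh (x : R) : R := ln (x + sqrt (x * x - 1)).

Definition hdist (z w : pt) : R :=
  arcosh (1 + 2 * ((fst z - fst w) ^ 2 + (snd z - snd w) ^ 2)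
                  / ((1 - nrm2 z) * (1 - nrm2 w))).

(** Isometries of H^2 (maps considered only through their values on the disk). *)
Definition is_isometry (g : pt -> pt) : Prop :=
  (forall x, in_disk x -> in_disk (g x)) /\
  (forall y, in_disk y -> exists x, in_disk x /\ g x = y) /\
  (forall x y, in_disk x -> in_disk y -> hdist (g x) (g y) = hdist x y).

Definition eq_on_disk (f g : pt -> pt) : Prop :=
  forall x, in_disk x -> f x = g x.

Definition is_subgroup (G : (pt -> pt) -> Prop) : Prop :=
  (forall g, G g -> is_isometry g) /\
  G (fun x => x) /\
  (forall g h, G g -> G h -> G (fun x => g (h x))) /\
  (forall g, G g -> exists h, G h /\ eq_on_disk (fun x => h (g x)) (fun x => x)
                                  /\ eq_on_disk (fun x => g (h x)) (fun x => x)).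

(** Discreteness in the compact-open topology: every element g is isolated,
    i.e. has a basic neighbourhood {h | sup_{x in K} d(h x, g x) < eps}
    (K a closed hyperbolic ball about the origin; every compact set lies in one)
    meeting G only in g. *)
Definition discrete_subgroup (G : (pt -> pt) -> Prop) : Prop :=
  is_subgroup G /\
  forall g, G g -> exists Rad eps, 0 < eps /\
    forall h, G h ->
      (forall x, in_disk x -> hdist origin x <= Rad -> hdist (h x) (g x) < eps) ->
      eq_on_disk h g.

Fixpoint word_comp (w : list (pt -> pt)) : pt -> pt :=
  match w with
  | nil => fun x => x
  | h :: w' => fun x => h (word_comp w' x)
  end.

Definition generated_by (G : (pt -> pt) -> Prop) (L : list (pt -> pt)) : Prop :=
  (forall l, In l L -> G l) /\
  forall g, G g -> exists w : list (pt -> pt),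
    (forall h, In h w ->
       In h L \/ (G h /\ exists l, In l L /\
                   eq_on_disk (fun x => h (l x)) (fun x => x))) /\
    eq_on_disk g (word_comp w).

Definition finitely_generated (G : (pt -> pt) -> Prop) : Prop :=
  exists L, generated_by G L.

Definition infinitely_generated (G : (pt -> pt) -> Prop) : Prop :=
  ~ finitely_generated G.

Definition limit_set (G : (pt -> pt) -> Prop) (xi : pt) : Prop :=
  on_circle xi /\
  forall eps, 0 < eps -> exists g, G g /\ eucl_dist (g origin) xi < eps.

(** Geodesic ray from the origin to xi, unit speed: r(t) = tanh(t/2) xi. *)
Definition geod_ray (xi : pt) (t : R) : pt := scal (tanh (t / 2)) xi.

(** Nonconical: the projection of the ray to H^2/G eventually leaves every
    compact set of the quotient; every compact set of the quotient lies in the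
    image of a closed ball B(origin, Rad), so this says: for every Rad,
    eventually r(t) is not in G.B(origin, Rad). *)
Definition nonconical_limit_set (G : (pt -> pt) -> Prop) (xi : pt) : Prop :=
  limit_set G xi /\
  forall Rad, exists T, forall t, T <= t -> forall g, G g ->
    forall y, in_disk y -> hdist origin y <= Rad -> g y <> geod_ray xi t.

Definition ang_dist (p q : pt) : R := acos (fst p * fst q + snd p * snd q).

(** Diameter (angular metric) of the part of U on the circle (0 if empty). *)
Definition ang_diam (U : pt -> Prop) : R :=
  match Lub_Rbar (fun d => exists p q, U p /\ U q /\ on_circle p /\ on_circle q
                                       /\ d = ang_dist p q) with
  | Finite r => r
  | _ => 0
  end.

(** d^s for d >= 0 and s > 0 (with 0^s = 0). *)
Definition rpow (d s : R) : R := if Rle_dec d 0 then 0 else Rpower d s.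

Definition hausdorff_delta (s delta : R) (A : pt -> Prop) : Rbar :=
  Glb_Rbar (fun v => exists U : nat -> pt -> Prop,
    (forall p, A p -> exists n, U n p) /\
    (forall n, ang_diam (U n) <= delta) /\
    is_series (fun n => rpow (ang_diam (U n)) s) v).

(** H^s(A) = sup_{delta > 0} H^s_delta(A); since each H^s_delta(A) >= 0,
    H^s(A) = 0 iff H^s_delta(A) = 0 for every delta > 0. *)
Definition hausdorff_null (s : R) (A : pt -> Prop) : Prop :=
  forall delta, 0 < delta -> hausdorff_delta s delta A = Finite 0.

Definition hausdorff_dim (A : pt -> Prop) : Rbar :=
  Glb_Rbar (fun s => 0 < s /\ hausdorff_null s A).

(* Main.v *)
From Stdlib Require Import Reals Ranalysis5 List Lra Lia ClassicalEpsilon.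
From Coquelicot Require Import Coquelicot.
Require Import Defs.
Import ListNotations.
Open Scope R_scope.

(** The group is the infinite free product of copies of Z/2 generated by the
    reflections in pairwise disjoint geodesics that accumulate at a single ideal
    point.  By ping-pong it is discrete and not finitely generated, and a limit
    point is either in the countable orbit of the accumulation point or is coded
    by the infinite sequence of walls crossed by the ray from the origin.  Each
    crossing of a wall of index i happens at a point whose distance to the orbit
    of the origin is bounded in terms of i, so along the code of a nonconical
    limit point the indices tend to infinity.  The i-th reflection contracts by a
    factor at most 2^-(i+1)^2, which for every s > 0 eventually beats the entropy
    of the code, so the cylinders given by long prefixes form covers
    of arbitrarily small s-dimensional size. *)

(** * Inversions in circles orthogonal to the unit circle *)

Definition sqdist (p q : pt) : R := (fst p - fst q) ^ 2 + (snd p - snd q) ^ 2.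

Definition inversion (c : pt) (r : R) (z : pt) : pt :=
  (fst c + r ^ 2 / sqdist z c * (fst z - fst c),
   snd c + r ^ 2 / sqdist z c * (snd z - snd c)).

Definition in_closed_disk (z : pt) : Prop := nrm2 z <= 1.

Lemma sqdist_ge0 p q : 0 <= sqdist p q.
Proof. apply Rplus_le_le_0_compat; apply pow2_ge_0. Qed.

Lemma sqdist_eq0 p q : sqdist p q = 0 -> p = q.
Proof.
  destruct p as [p1 p2], q as [q1 q2]; unfold sqdist; simpl fst; simpl snd.
  rewrite <- !Rsqr_pow2; intros H; apply Rplus_sqr_eq_0 in H as [H1 H2].
  f_equal; lra.
Qed.

Lemma eucl_dist_sqr p q : eucl_dist p q ^ 2 = sqdist p q.
Proof. exact (pow2_sqrt _ (sqdist_ge0 p q)). Qed.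

Lemma eucl_dist_ge0 p q : 0 <= eucl_dist p q.
Proof. apply sqrt_pos. Qed.

Lemma eucl_dist_le p q d : 0 <= d -> sqdist p q <= d ^ 2 -> eucl_dist p q <= d.
Proof.
  intros Hd H; pose proof (eucl_dist_sqr p q); pose proof (eucl_dist_ge0 p q); nra.
Qed.

Lemma eucl_dist_sym p q : eucl_dist p q = eucl_dist q p.
Proof. unfold eucl_dist; f_equal; ring. Qed.

Lemma eucl_dist_triangle p q m : eucl_dist p q <= eucl_dist p m + eucl_dist m q.
Proof.
  destruct p as [p1 p2], q as [q1 q2], m as [m1 m2].
  pose proof (triangle p1 p2 q1 q2 m1 m2) as H.
  unfold dist_euc, Rsqr in H; unfold eucl_dist; simpl.
  rewrite !Rmult_1_r; exact H.
Qed.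

Lemma eucl_dist_coord p q :
  Rabs (fst p - fst q) <= eucl_dist p q /\ Rabs (snd p - snd q) <= eucl_dist p q.
Proof.
  pose proof (eucl_dist_sqr p q) as H; pose proof (eucl_dist_ge0 p q).
  revert H; unfold sqdist; generalize (fst p - fst q) (snd p - snd q); intros x y H.
  split; apply Rabs_le; split; nra.
Qed.

Lemma eucl_dist_le_coord p q :
  eucl_dist p q <= Rabs (fst p - fst q) + Rabs (snd p - snd q).
Proof.
  apply eucl_dist_le.
  - pose proof (Rabs_pos (fst p - fst q)); pose proof (Rabs_pos (snd p - snd q)); lra.
  - unfold sqdist; rewrite <- (pow2_abs (fst p - fst q)), <- (pow2_abs (snd p - snd q)).
    pose proof (Rabs_pos (fst p - fst q)); pose proof (Rabs_pos (snd p - snd q)); nra.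
Qed.

Lemma sqdist_inversion_center c r z :
  0 < sqdist z c -> sqdist (inversion c r z) c = r ^ 4 / sqdist z c.
Proof.
  destruct c as [c1 c2], z as [z1 z2].
  unfold inversion, sqdist; simpl fst; simpl snd; intros; field; lra.
Qed.

Lemma sqdist_inversion c r z w : 0 < sqdist z c -> 0 < sqdist w c ->
  sqdist (inversion c r z) (inversion c r w) =
  r ^ 4 * sqdist z w / (sqdist z c * sqdist w c).
Proof.
  destruct c as [c1 c2], z as [z1 z2], w as [w1 w2].
  unfold inversion, sqdist; simpl fst; simpl snd; intros; field; split; lra.
Qed.

Lemma inversion_involutive c r z :
  0 < r -> 0 < sqdist z c -> inversion c r (inversion c r z) = z.
Proof.
  intros Hr Hz; pose proof (sqdist_inversion_center c r z Hz) as H.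
  unfold inversion at 1; rewrite H; unfold inversion; simpl fst; simpl snd.
  destruct z as [z1 z2]; simpl in *; f_equal; field; split; lra.
Qed.

(* [sqdist a b * (1 - |z|^2)^2 / (sqdist z a * sqdist z b)] is a conformal
   invariant, and it is at least 1 when z lies on the ray from a = 0 to b. *)
Definition near_geodesic (a b z : pt) : Prop :=
  sqdist z b * sqdist z a <= sqdist a b * (1 - nrm2 z) ^ 2.

Section Orthogonal.

Variables (c : pt) (r : R).
Hypotheses (r_gt0 : 0 < r) (orth : nrm2 c = 1 + r ^ 2).

Lemma sqdist_center_gt0 z : in_closed_disk z -> 0 < sqdist z c.
Proof.
  intros H; destruct (sqdist_ge0 z c) as [|E]; [assumption|].
  symmetry in E; apply sqdist_eq0 in E; subst z; unfold in_closed_disk in H; nra.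
Qed.

(** Substituting [r ^ 2 = nrm2 c - 1] leaves a rational identity. The factor [r ^ 2 / sqdist z c] is
    the conformal factor of the inversion, so it cancels in hyperbolic distances and in
    [near_geodesic], and its sign shows that the disk and the circle are preserved. *)
Lemma nrm2_inversion z : in_closed_disk z ->
  1 - nrm2 (inversion c r z) = r ^ 2 * (1 - nrm2 z) / sqdist z c.
Proof.
  intros Hz; pose proof (sqdist_center_gt0 z Hz) as Hp; revert Hp.
  assert (E : r ^ 2 = nrm2 c - 1) by lra.
  unfold inversion; rewrite E.
  destruct c as [c1 c2], z as [z1 z2]; unfold sqdist, nrm2; simpl fst; simpl snd.
  intros; field; lra.
Qed.

Lemma inversion_closed_disk z : in_closed_disk z -> in_closed_disk (inversion c r z).
Proof.
  intros Hz; pose proof (nrm2_inversion z Hz) as H; unfold in_closed_disk in *.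
  pose proof (sqdist_center_gt0 z Hz).
  assert (0 <= r ^ 2 * (1 - nrm2 z) / sqdist z c).
  { apply Rdiv_le_0_compat; [apply Rmult_le_pos; nra | assumption]. }
  lra.
Qed.

Lemma inversion_disk z : in_disk z -> in_disk (inversion c r z).
Proof.
  intros Hz; assert (Hc : in_closed_disk z) by (apply Rlt_le; exact Hz).
  pose proof (nrm2_inversion z Hc) as H; unfold in_disk in *.
  pose proof (sqdist_center_gt0 z Hc).
  assert (0 < r ^ 2 * (1 - nrm2 z) / sqdist z c).
  { apply Rdiv_lt_0_compat; [apply Rmult_lt_0_compat; nra | assumption]. }
  lra.
Qed.

Lemma inversion_circle z : on_circle z -> on_circle (inversion c r z).
Proof.
  intros Hz; assert (Hc : in_closed_disk z) by (apply Req_le; exact Hz).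
  pose proof (nrm2_inversion z Hc) as H; unfold on_circle in *.
  rewrite Hz, Rminus_diag in H; unfold Rdiv in H.
  rewrite Rmult_0_r, Rmult_0_l in H; lra.
Qed.

Lemma hdist_inversion z w : in_disk z -> in_disk w ->
  hdist (inversion c r z) (inversion c r w) = hdist z w.
Proof.
  intros Hz Hw.
  assert (Hz' : in_closed_disk z) by (apply Rlt_le; exact Hz).
  assert (Hw' : in_closed_disk w) by (apply Rlt_le; exact Hw).
  pose proof (sqdist_center_gt0 z Hz'); pose proof (sqdist_center_gt0 w Hw').
  unfold hdist; fold (sqdist z w); fold (sqdist (inversion c r z) (inversion c r w)).
  rewrite !nrm2_inversion, sqdist_inversion by assumption.
  unfold in_disk in *; f_equal; f_equal; field; repeat split; lra.
Qed.

Lemma near_geodesic_inversion a b z :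
  in_closed_disk a -> in_closed_disk b -> in_closed_disk z ->
  near_geodesic a b z ->
  near_geodesic (inversion c r a) (inversion c r b) (inversion c r z).
Proof.
  intros Ha Hb Hz H; unfold near_geodesic in *.
  pose proof (sqdist_center_gt0 a Ha); pose proof (sqdist_center_gt0 b Hb).
  pose proof (sqdist_center_gt0 z Hz).
  rewrite nrm2_inversion, !sqdist_inversion by assumption.
  (* Both sides of the inequality are multiplied by this same factor under the inversion. *)
  set (k := r ^ 8 / (sqdist a c * sqdist b c * sqdist z c ^ 2)).
  assert (Hk : 0 <= k).
  { apply Rdiv_le_0_compat; [apply pow_le; lra |].
    repeat apply Rmult_lt_0_compat; simpl; lra. }
  apply (Rmult_le_compat_l k _ _ Hk) in H.
  eapply Rle_trans; [eapply Rle_trans; [|exact H]|]; apply Req_le; unfold k; field;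
    repeat split; lra.
Qed.

End Orthogonal.

(** * The reflections *)

(* The walls accumulate only at [accum]; their radii shrink so fast compared
   with their distances [gap] to each other that [sum_i (rad i / gap i)^s]
   converges for every s > 0. *)
Definition height (i : nat) : R := (/ 2) ^ S i.
Definition ratio (i : nat) : R := (/ 2) ^ (S i * S i).
Definition gap (i : nat) : R := height i / 4.
Definition rad (i : nat) : R := gap i * ratio i.
(** The abscissa is the one that makes the wall orthogonal to the unit circle. *)
Definition ctr (i : nat) : pt := (sqrt (1 + rad i ^ 2 - height i ^ 2), height i).
Definition refl (i : nat) : pt -> pt := inversion (ctr i) (rad i).
Definition accum : pt := (1, 0).

Definition in_ball (i : nat) (z : pt) : Prop := eucl_dist z (ctr i) <= rad i.
(** Ping-pong lands in the half-sized ball. The margin to the full ball forces consecutive letters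
    of a code to differ and keeps wall crossings away from the endpoint of the ray. *)
Definition in_core (i : nat) (z : pt) : Prop := eucl_dist z (ctr i) <= rad i / 2.

Lemma half_pow_bounds n : 0 < (/ 2) ^ n <= 1.
Proof. split; [apply pow_lt; lra | induction n; simpl; lra]. Qed.

Lemma half_pow_le m n : (m <= n)%nat -> (/ 2) ^ n <= (/ 2) ^ m.
Proof.
  intros H; replace n with (m + (n - m))%nat by lia; rewrite pow_add.
  pose proof (half_pow_bounds m); pose proof (half_pow_bounds (n - m)); nra.
Qed.

Lemma height_bounds i : 0 < height i <= / 2.
Proof. unfold height; simpl; pose proof (half_pow_bounds i); lra. Qed.

Lemma height_lt i j : (i < j)%nat -> height j <= height i / 2.
Proof.
  intros H; pose proof (half_pow_le (S (S i)) (S j) ltac:(lia)) as K.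
  unfold height; simpl in *; lra.
Qed.

Lemma ratio_bounds i : 0 < ratio i <= / 2.
Proof.
  unfold ratio; split; [apply pow_lt; lra |].
  pose proof (half_pow_le 1 (S i * S i) ltac:(lia)); simpl in *; lra.
Qed.

Lemma gap_gt0 i : 0 < gap i.
Proof. pose proof (height_bounds i); unfold gap; lra. Qed.

Lemma rad_bounds i : 0 < rad i <= gap i / 2.
Proof.
  pose proof (gap_gt0 i); pose proof (ratio_bounds i); unfold rad; split; nra.
Qed.

Lemma rad_gt0 i : 0 < rad i.
Proof. apply rad_bounds. Qed.

Lemma rad_le i j : (i <= j)%nat -> rad j <= rad i.
Proof.
  intros H; unfold rad, gap, height, ratio.
  pose proof (half_pow_le (S i) (S j) ltac:(lia)).
  pose proof (half_pow_le (S i * S i) (S j * S j) ltac:(nia)).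
  pose proof (half_pow_bounds (S j)); pose proof (half_pow_bounds (S j * S j)).
  apply Rmult_le_compat; lra.
Qed.

Lemma ctr_sqr i : fst (ctr i) ^ 2 = 1 + rad i ^ 2 - height i ^ 2.
Proof.
  unfold ctr, fst; apply pow2_sqrt.
  pose proof (height_bounds i); pose proof (rad_gt0 i); nra.
Qed.

Lemma fst_ctr_bounds i : 1 - height i ^ 2 <= fst (ctr i) <= 1.
Proof.
  pose proof (ctr_sqr i) as H; pose proof (height_bounds i).
  pose proof (rad_bounds i) as Hr; unfold gap in Hr.
  assert (0 <= fst (ctr i)) by apply sqrt_pos.
  split; nra.
Qed.

Lemma ctr_orth i : nrm2 (ctr i) = 1 + rad i ^ 2.
Proof. pose proof (ctr_sqr i); unfold nrm2; simpl snd; lra. Qed.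

(** Second coordinates suffice: heights at least halve with each index, so two of them differ by at
    least half the larger one, while [rad j] is at most [height j / 8]. *)
Lemma ball_separated i j z : i <> j -> in_ball j z -> gap i <= eucl_dist z (ctr i).
Proof.
  intros Hij Hz; red in Hz.
  pose proof (proj2 (eucl_dist_coord z (ctr j))) as H1.
  pose proof (proj2 (eucl_dist_coord z (ctr i))) as H2; simpl snd in *.
  pose proof (rad_bounds j) as Hr; pose proof (height_bounds i).
  pose proof (height_bounds j); unfold gap in *.
  assert (height i <= height j / 2 \/ height j <= height i / 2) as Hh.
  { destruct (Nat.lt_gt_cases i j) as [K _]; destruct (K Hij);
      [right | left]; apply height_lt; assumption. }
  apply Rabs_le_between in H1; apply Rabs_le_between in H2; destruct Hh; lra.
Qed.

Lemma origin_separated i : gap i <= eucl_dist origin (ctr i).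
Proof.
  pose proof (proj2 (eucl_dist_coord origin (ctr i))) as H.
  pose proof (height_bounds i); simpl snd in H; unfold gap.
  apply Rabs_le_between in H; lra.
Qed.

(** Source of the uniform displacement of the origin used for discreteness. *)
Lemma ball_nrm2 i z : in_ball i z -> / 16 <= nrm2 z.
Proof.
  intros Hz; red in Hz; pose proof (proj1 (eucl_dist_coord z (ctr i))) as H.
  pose proof (fst_ctr_bounds i); pose proof (rad_bounds i); pose proof (height_bounds i).
  unfold gap in *; apply Rabs_le_between in H; unfold nrm2.
  assert (/ 4 <= fst z) by nra; nra.
Qed.

(** As heights tend to 0, only finitely many balls stay away from [accum]. *)
Lemma ball_near_accum i z : in_ball i z -> eucl_dist z accum <= 3 * height i.
Proof.
  intros Hz; red in Hz; pose proof (eucl_dist_coord z (ctr i)) as [H1 H2].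
  pose proof (fst_ctr_bounds i); pose proof (rad_bounds i); pose proof (height_bounds i).
  unfold gap in *; simpl snd in H2.
  eapply Rle_trans; [apply eucl_dist_le_coord|]; simpl fst; simpl snd.
  apply Rabs_le_between in H1; apply Rabs_le_between in H2.
  assert (height i ^ 2 <= height i / 2) by nra.
  assert (Rabs (fst z - 1) <= height i) by (apply Rabs_le; lra).
  assert (Rabs (snd z - 0) <= 2 * height i) by (apply Rabs_le; lra).
  lra.
Qed.

Lemma core_ball i z : in_core i z -> in_ball i z.
Proof. unfold in_core, in_ball; pose proof (rad_gt0 i); lra. Qed.

Lemma ctr_dist_gt0 i z : in_closed_disk z -> 0 < eucl_dist z (ctr i).
Proof.
  intros H; apply sqrt_lt_R0.
  exact (sqdist_center_gt0 _ _ (rad_gt0 i) (ctr_orth i) z H).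
Qed.

Lemma refl_dist_ctr i z : in_closed_disk z ->
  eucl_dist (refl i z) (ctr i) = rad i ^ 2 / eucl_dist z (ctr i).
Proof.
  intros H; pose proof (ctr_dist_gt0 i z H); pose proof (rad_gt0 i).
  apply Rsqr_inj; [apply eucl_dist_ge0 | apply Rdiv_le_0_compat; nra |].
  rewrite !Rsqr_pow2, eucl_dist_sqr; unfold refl.
  rewrite sqdist_inversion_center, <- eucl_dist_sqr.
  - field; lra.
  - rewrite <- eucl_dist_sqr; nra.
Qed.

Lemma refl_dist i z w : in_closed_disk z -> in_closed_disk w ->
  eucl_dist (refl i z) (refl i w) =
  rad i ^ 2 * eucl_dist z w / (eucl_dist z (ctr i) * eucl_dist w (ctr i)).
Proof.
  intros Hz Hw; pose proof (ctr_dist_gt0 i z Hz); pose proof (ctr_dist_gt0 i w Hw).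
  apply Rsqr_inj; [apply eucl_dist_ge0 | |].
  - apply Rdiv_le_0_compat; [|nra].
    apply Rmult_le_pos; [nra | apply eucl_dist_ge0].
  - rewrite !Rsqr_pow2, eucl_dist_sqr; unfold refl.
    rewrite sqdist_inversion; [| rewrite <- eucl_dist_sqr; nra ..].
    rewrite <- !eucl_dist_sqr; field; split; lra.
Qed.

Lemma refl_closed_disk i z : in_closed_disk z -> in_closed_disk (refl i z).
Proof. apply inversion_closed_disk; [apply rad_gt0 | apply ctr_orth]. Qed.

Lemma refl_disk i z : in_disk z -> in_disk (refl i z).
Proof. apply inversion_disk; [apply rad_gt0 | apply ctr_orth]. Qed.

Lemma refl_circle i z : on_circle z -> on_circle (refl i z).
Proof. apply inversion_circle; [apply rad_gt0 | apply ctr_orth]. Qed.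

Lemma refl_involutive i z : in_closed_disk z -> refl i (refl i z) = z.
Proof.
  intros H; apply inversion_involutive; [apply rad_gt0 |].
  exact (sqdist_center_gt0 _ _ (rad_gt0 i) (ctr_orth i) z H).
Qed.

(** The ping-pong step: [rad i ^ 2 / gap i] is at most [rad i / 2]. The origin and all points of the
    other balls satisfy the distance hypothesis. *)
Lemma refl_in_core i z :
  in_closed_disk z -> gap i <= eucl_dist z (ctr i) -> in_core i (refl i z).
Proof.
  intros Hz Hg; red; rewrite refl_dist_ctr by assumption.
  pose proof (rad_bounds i); pose proof (gap_gt0 i).
  apply <- Rle_div_l; [|lra].
  assert (rad i <= eucl_dist z (ctr i) / 2) by lra; nra.
Qed.

Lemma core_refl_separated i z :
  in_closed_disk z -> in_core i z -> 2 * rad i <= eucl_dist (refl i z) (ctr i).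
Proof.
  intros Hz Hg; red in Hg; rewrite refl_dist_ctr by assumption.
  pose proof (rad_gt0 i); pose proof (ctr_dist_gt0 i z Hz).
  apply -> Rle_div_r; nra.
Qed.

(** The scaling factor in [refl_dist] is at most [(rad i / gap i) ^ 2], which is [ratio i ^ 2] and
    hence at most [ratio i]. *)
Lemma refl_contraction i z w : in_closed_disk z -> in_closed_disk w ->
  gap i <= eucl_dist z (ctr i) -> gap i <= eucl_dist w (ctr i) ->
  eucl_dist (refl i z) (refl i w) <= ratio i * eucl_dist z w.
Proof.
  intros Hz Hw Gz Gw; rewrite refl_dist by assumption.
  pose proof (gap_gt0 i); pose proof (ratio_bounds i); pose proof (eucl_dist_ge0 z w).
  apply <- Rle_div_l; [|nra].
  assert (rad i ^ 2 <= ratio i * (eucl_dist z (ctr i) * eucl_dist w (ctr i))) as K.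
  { apply Rle_trans with (ratio i * (gap i * gap i)).
    - unfold rad; nra.
    - apply Rmult_le_compat_l; [lra | apply Rmult_le_compat; lra]. }
  nra.
Qed.

(** * The group generated by the reflections *)

Fixpoint act (w : list nat) (z : pt) : pt :=
  match w with
  | [] => z
  | i :: w' => refl i (act w' z)
  end.

Definition Gamma (g : pt -> pt) : Prop := exists w, eq_on_disk g (act w).

Fixpoint reduced (w : list nat) : Prop :=
  match w with
  | [] => True
  | i :: w' => match w' with [] => True | j :: _ => i <> j end /\ reduced w'
  end.

Lemma disk_closed_disk z : in_disk z -> in_closed_disk z.
Proof. apply Rlt_le. Qed.

Lemma circle_closed_disk z : on_circle z -> in_closed_disk z.
Proof. apply Req_le. Qed.

Lemma origin_in_disk : in_disk origin.
Proof. unfold in_disk, nrm2, origin; simpl; lra. Qed.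

Lemma act_app w w' z : act (w ++ w') z = act w (act w' z).
Proof. induction w as [|i w IH]; simpl; [|rewrite IH]; reflexivity. Qed.

Lemma act_disk w z : in_disk z -> in_disk (act w z).
Proof. intros H; induction w; simpl; [|apply refl_disk]; assumption. Qed.

Lemma act_closed_disk w z : in_closed_disk z -> in_closed_disk (act w z).
Proof. intros H; induction w; simpl; [|apply refl_closed_disk]; assumption. Qed.

Lemma act_rev_l w z : in_closed_disk z -> act (rev w) (act w z) = z.
Proof.
  intros H; induction w as [|i w IH]; simpl; [reflexivity|].
  rewrite act_app; simpl; rewrite refl_involutive; [exact IH|].
  apply act_closed_disk, H.
Qed.

Lemma act_rev_r w z : in_closed_disk z -> act w (act (rev w) z) = z.
Proof.
  intros H; pose proof (act_rev_l (rev w) z H) as K; rewrite rev_involutive in K; exact K.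
Qed.

Lemma hdist_act w x y :
  in_disk x -> in_disk y -> hdist (act w x) (act w y) = hdist x y.
Proof.
  intros Hx Hy; induction w as [|i w IH]; simpl; [reflexivity|].
  rewrite <- IH; apply hdist_inversion;
    [apply rad_gt0 | apply ctr_orth | apply act_disk .. ]; assumption.
Qed.

(** Adjacent equal letters cancel because reflections are involutions. Keeping track of the letters
    serves the proof that [Gamma] is not finitely generated. *)
Lemma reduce_word w : exists w', reduced w' /\ (forall i, In i w' -> In i w) /\
  eq_on_disk (act w) (act w').
Proof.
  induction w as [|i w (w' & Hred & Hin & Heq)].
  { exists []; repeat split; auto. }
  destruct w' as [|j v].
  - exists [i]; repeat split; [|intros x Hx; simpl; rewrite (Heq x Hx); reflexivity].
    intros k [<-|[]]; left; reflexivity.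
  - destruct (Nat.eq_dec i j) as [<-|Hij].
    + exists v; repeat split; [apply Hred | |].
      * intros k Hk; right; apply Hin; right; exact Hk.
      * intros x Hx; simpl; rewrite (Heq x Hx); simpl; apply refl_involutive.
        apply act_closed_disk, disk_closed_disk, Hx.
    + exists (i :: j :: v); split; [split; assumption|]; split.
      * intros k [<-|Hk]; [left; reflexivity | right; apply Hin, Hk].
      * intros x Hx; simpl; rewrite (Heq x Hx); reflexivity.
Qed.

(** Before the last reflection the point is the origin or lies in a ball of another index; either
    way ping-pong applies. *)
Lemma orbit_in_core i w : reduced (i :: w) -> in_core i (act (i :: w) origin).
Proof.
  revert i; induction w as [|j w IH]; intros i H; simpl act.
  - apply refl_in_core; [apply disk_closed_disk, origin_in_disk | apply origin_separated].
  - destruct H as [Hij H]; apply refl_in_core.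
    + apply (act_closed_disk (j :: w)), disk_closed_disk, origin_in_disk.
    + apply (ball_separated i j); [exact Hij |].
      apply core_ball, IH, H.
Qed.

Lemma Gamma_subgroup : is_subgroup Gamma.
Proof.
  repeat split.
  - destruct H as [w Hw]; intros x Hx; rewrite Hw by exact Hx; apply act_disk, Hx.
  - destruct H as [w Hw]; intros y Hy; exists (act (rev w) y).
    pose proof (act_disk (rev w) y Hy); split; [assumption|].
    rewrite Hw by assumption; apply act_rev_r, disk_closed_disk, Hy.
  - destruct H as [w Hw]; intros x y Hx Hy; rewrite !Hw by assumption.
    apply hdist_act; assumption.
  - exists []; intros x _; reflexivity.
  - intros g h [w Hw] [v Hv]; exists (w ++ v); intros x Hx.
    rewrite act_app, Hv by exact Hx; apply Hw, act_disk, Hx.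
  - intros g [w Hw]; exists (act (rev w)); split; [exists (rev w); intros x _; reflexivity|].
    split; intros x Hx.
    + rewrite Hw by exact Hx; apply act_rev_l, disk_closed_disk, Hx.
    + rewrite Hw by (apply act_disk, Hx); apply act_rev_r, disk_closed_disk, Hx.
Qed.

(** * Discreteness and infinite generation *)

Lemma hdist_origin x : hdist origin x =
  arcosh (1 + 2 * nrm2 x / (1 - nrm2 x)).
Proof.
  unfold hdist; replace (nrm2 origin) with 0 by (unfold nrm2; simpl; ring).
  replace ((fst origin - fst x) ^ 2 + (snd origin - snd x) ^ 2) with (nrm2 x)
    by (unfold nrm2; simpl; ring).
  rewrite Rminus_0_r, Rmult_1_l; reflexivity.
Qed.

Lemma arcosh_le x y : 1 <= x <= y -> arcosh x <= arcosh y.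
Proof.
  intros [H1 H2]; unfold arcosh; apply ln_le.
  - pose proof (sqrt_pos (x * x - 1)); lra.
  - apply Rplus_le_compat; [exact H2|]; apply sqrt_le_1_alt; nra.
Qed.

Lemma nrm2_ge0 x : 0 <= nrm2 x.
Proof. unfold nrm2; nra. Qed.

Lemma hdist_origin_ge m x : in_disk x -> 0 <= m -> m <= nrm2 x ->
  ln (1 + 2 * m) <= hdist origin x.
Proof.
  unfold in_disk; intros Hx Hm H; rewrite hdist_origin; unfold arcosh.
  pose proof (sqrt_pos ((1 + 2 * nrm2 x / (1 - nrm2 x)) * (1 + 2 * nrm2 x / (1 - nrm2 x)) - 1)).
  assert (2 * m <= 2 * nrm2 x / (1 - nrm2 x)) by (apply -> Rle_div_r; nra).
  apply ln_le; lra.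
Qed.

Lemma hdist_origin_le d x : 0 < d <= 1 - nrm2 x -> hdist origin x <= arcosh (1 + 2 / d).
Proof.
  intros [H1 H2]; rewrite hdist_origin; pose proof (nrm2_ge0 x).
  assert (0 <= 2 * nrm2 x / (1 - nrm2 x)) by (apply Rdiv_le_0_compat; lra).
  apply arcosh_le; split; [lra|]; apply Rplus_le_compat_l.
  unfold Rdiv; apply Rmult_le_compat; [lra | | lra | apply Rinv_le_contravar; lra].
  left; apply Rinv_0_lt_compat; lra.
Qed.

Lemma Gamma_discrete : discrete_subgroup Gamma.
Proof.
  split; [exact Gamma_subgroup|].
  (* The test at the origin alone is enough: this radius just admits the origin, and by [ball_nrm2]
     a nonempty reduced word moves it at least as far as this epsilon. *)
  intros g [w Hw]; exists (hdist origin origin), (ln (1 + 2 * / 16)).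
  split; [rewrite <- ln_1; apply ln_increasing; lra|].
  intros h [v Hv] H.
  pose proof origin_in_disk as O.
  specialize (H origin O (Rle_refl _)).
  rewrite Hw, Hv, <- (hdist_act (rev v)) in H by (try apply act_disk; assumption).
  rewrite act_rev_l, <- act_app in H by (apply disk_closed_disk, O).
  destruct (reduce_word (rev v ++ w)) as (u & Hred & _ & Heq).
  rewrite (Heq origin O) in H; destruct u as [|i u].
  - intros x Hx; rewrite Hw, Hv by exact Hx.
    pose proof (Heq x Hx) as E; simpl in E; rewrite <- E at 1.
    rewrite act_app; apply act_rev_r, disk_closed_disk, act_disk, Hx.
  - pose proof (ball_nrm2 _ _ (core_ball _ _ (orbit_in_core i u Hred))) as K.
    apply (hdist_origin_ge (/ 16)) in K; [lra | apply act_disk, O | lra].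
Qed.

Lemma Gamma_bounded_letters L : (forall l, In l L -> Gamma l) ->
  exists N, forall l, In l L ->
    exists w, (forall i, In i w -> (i < N)%nat) /\ eq_on_disk l (act w).
Proof.
  induction L as [|l L IH]; intros H.
  { exists O; intros l []. }
  destruct IH as [N HN]; [intros k Hk; apply H; right; exact Hk|].
  destruct (H l (or_introl eq_refl)) as [w Hw].
  exists (Nat.max N (S (list_max w))); intros k [<-|Hk].
  - exists w; split; [|exact Hw]; intros i Hi.
    pose proof (proj1 (list_max_le w (list_max w)) (le_n _)) as F.
    rewrite Forall_forall in F; specialize (F i Hi); lia.
  - destruct (HN k Hk) as (v & Hv & E); exists v; split; [|exact E].
    intros i Hi; specialize (Hv i Hi); lia.
Qed.

(** Finitely many generators involve only letters below some [N]. A reduced word in such letters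
    keeps the origin at distance at least [gap N] from [ctr N], whereas [refl N] brings it within
    [rad N]. *)
Lemma Gamma_infinitely_generated : infinitely_generated Gamma.
Proof.
  intros (L & HL & Hgen); destruct (Gamma_bounded_letters L HL) as [N HN].
  destruct (Hgen (refl N)) as (w & Hw & Heq).
  { exists [N]; intros x _; reflexivity. }
  assert (K : exists v, (forall i, In i v -> (i < N)%nat) /\ eq_on_disk (word_comp w) (act v)).
  { clear Heq; induction w as [|h w IH].
    - exists []; split; [intros i [] | intros x _; reflexivity].
    - destruct IH as (v & Hv & Ev); [intros k Hk; apply Hw; right; exact Hk|].
      assert (exists u, (forall i, In i u -> (i < N)%nat) /\ eq_on_disk h (act u))
        as (u & Hu & Eu).
      (* A left inverse of [act u] on the disk agrees there with [act (rev u)], which uses the same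
         letters. *)
      { destruct (Hw h (or_introl eq_refl)) as [Hh | (_ & l & Hl & E)]; [exact (HN h Hh)|].
        destruct (HN l Hl) as (u & Hu & Eu); exists (rev u); split.
        - intros i Hi; apply Hu, in_rev, Hi.
        - intros x Hx; pose proof (act_disk (rev u) x Hx) as Hy.
          rewrite <- (E _ Hy), (Eu _ Hy), act_rev_r; [reflexivity|].
          apply disk_closed_disk, Hx. }
      exists (u ++ v); split.
      + intros i Hi; apply in_app_or in Hi as [Hi|Hi]; auto.
      + intros x Hx; simpl; rewrite act_app, (Ev x Hx); apply Eu, act_disk, Hx. }
  destruct K as (v & Hv & Ev).
  destruct (reduce_word v) as (u & Hred & Hin & Eu).
  pose proof origin_in_disk as O.
  pose proof (Heq origin O) as E; rewrite (Ev _ O), (Eu _ O) in E.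
  pose proof (orbit_in_core N [] (conj I I)) as C; apply core_ball in C.
  simpl in C; rewrite E in C; red in C.
  pose proof (rad_bounds N); pose proof (gap_gt0 N).
  destruct u as [|i u].
  - pose proof (origin_separated N); simpl in C; lra.
  - assert (i < N)%nat by (apply Hv, Hin; left; reflexivity).
    pose proof (ball_separated N i (act (i :: u) origin) ltac:(lia)
                  (core_ball _ _ (orbit_in_core i u Hred))); lra.
Qed.

(** * Coding of limit points *)

Fixpoint cyl (w : list nat) (z : pt) : Prop :=
  match w with
  | [] => True
  | i :: w' => in_ball i z /\ cyl w' (refl i z)
  end.

(** The product of the ratios along [w] is [(/ 2) ^ square_weight w]. *)
Fixpoint square_weight (w : list nat) : nat :=
  match w with
  | [] => 0
  | i :: w' => S i * S i + square_weight w'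
  end.

(** Every letter but the last contributes its contraction factor, since the reflected points lie in
    a ball of another index; the last contributes the diameter of its ball, at most its ratio. *)
Lemma cyl_dist w z z' : w <> [] -> reduced w ->
  in_closed_disk z -> in_closed_disk z' -> cyl w z -> cyl w z' ->
  eucl_dist z z' <= (/ 2) ^ square_weight w.
Proof.
  revert z z'; induction w as [|i w IH]; intros z z' Hne Hred Hz Hz' Cz Cz'; [easy|].
  destruct Cz as [Bz Cz], Cz' as [Bz' Cz']; destruct w as [|j w].
  - pose proof (eucl_dist_triangle z z' (ctr i)); red in Bz, Bz'.
    rewrite (eucl_dist_sym (ctr i)) in H.
    pose proof (height_bounds i); pose proof (ratio_bounds i).
    replace (square_weight [i]) with (S i * S i)%nat by (simpl; lia).
    change ((/ 2) ^ (S i * S i)) with (ratio i).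
    assert (height i * ratio i <= / 2 * ratio i) by (apply Rmult_le_compat_r; lra).
    unfold rad, gap in *; lra.
  - destruct Hred as [Hij Hred].
    pose proof (refl_closed_disk i z Hz) as Dz; pose proof (refl_closed_disk i z' Hz') as Dz'.
    pose proof (IH _ _ ltac:(easy) Hred Dz Dz' Cz Cz') as D.
    rewrite <- (refl_involutive i z), <- (refl_involutive i z') by assumption.
    eapply Rle_trans.
    { apply refl_contraction; [assumption .. | |].
      - apply (ball_separated i j); [assumption | apply Cz].
      - apply (ball_separated i j); [assumption | apply Cz']. }
    change (square_weight (i :: j :: w)) with (S i * S i + square_weight (j :: w))%nat.
    rewrite pow_add; apply Rmult_le_compat_l; [|exact D].
    left; apply ratio_bounds.
Qed.

(** With the closed ball at the last letter this covers both coded limit points and wall crossings,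
    which lie on the boundary of the ball. *)
Lemma cyl_act w i a : reduced (w ++ [i]) -> in_closed_disk a -> in_ball i a ->
  cyl (w ++ [i]) (act w a).
Proof.
  intros Hred Ha Bi; induction w as [|j w IH]; [split; [exact Bi | exact I]|].
  destruct Hred as [Hj Hred]; specialize (IH Hred).
  pose proof (act_closed_disk w a Ha) as Hc.
  split; [|simpl; rewrite refl_involutive; assumption].
  apply core_ball, refl_in_core; [exact Hc|].
  destruct w as [|k w].
  - apply (ball_separated j i); [exact Hj | apply IH].
  - apply (ball_separated j k); [exact Hj | apply IH].
Qed.

Lemma pow_half_small e : 0 < e -> exists n, (/ 2) ^ n < e.
Proof.
  intros He; destruct (pow_lt_1_zero (/ 2) ltac:(rewrite Rabs_pos_eq; lra) e He) as [n Hn].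
  exists n; specialize (Hn n (le_n n)); rewrite Rabs_pos_eq in Hn; [exact Hn|].
  left; apply half_pow_bounds.
Qed.

Lemma outside_cores xi N : (forall i, ~ in_core i xi) ->
  exists e, 0 < e /\ forall i, (i < N)%nat -> rad i / 2 + e <= eucl_dist xi (ctr i).
Proof.
  intros H; induction N as [|N (e & He & K)].
  { exists 1; split; [lra | lia]. }
  pose proof (H N) as HN; unfold in_core in HN; apply Rnot_le_lt in HN.
  exists (Rmin e (eucl_dist xi (ctr N) - rad N / 2)); split.
  { apply Rmin_glb_lt; lra. }
  pose proof (Rmin_l e (eucl_dist xi (ctr N) - rad N / 2)).
  pose proof (Rmin_r e (eucl_dist xi (ctr N) - rad N / 2)).
  intros i Hi; destruct (Nat.eq_dec i N) as [->|]; [lra|].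
  specialize (K i ltac:(lia)); lra.
Qed.

(** Orbit points other than the origin lie in cores. Cores of large index are close to [accum], and
    the finitely many others are closed, so a point in no core is not approached. *)
Lemma limit_point_core xi : limit_set Gamma xi -> xi <> accum -> exists i, in_core i xi.
Proof.
  intros [Hc Hlim] Hne; apply NNPP; intros H.
  assert (Hd : 0 < eucl_dist xi accum).
  { destruct (eucl_dist_ge0 xi accum) as [|E]; [assumption|].
    exfalso; apply Hne, sqdist_eq0; rewrite <- eucl_dist_sqr, <- E; ring. }
  destruct (pow_half_small (eucl_dist xi accum / 6)) as [N HN]; [lra|].
  destruct (outside_cores xi N) as (e & He & K); [intros i Hi; apply H; exists i; exact Hi|].
  (* The three bounds exclude a core of index below [N], the origin itself, and a core of index at
     least [N]. *)
  destruct (Hlim (Rmin (Rmin e (/ 2)) (eucl_dist xi accum / 2))) as (g & [w Hw] & Hg).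
  { repeat apply Rmin_glb_lt; lra. }
  pose proof (Rmin_l (Rmin e (/ 2)) (eucl_dist xi accum / 2)).
  pose proof (Rmin_r (Rmin e (/ 2)) (eucl_dist xi accum / 2)).
  pose proof (Rmin_l e (/ 2)); pose proof (Rmin_r e (/ 2)).
  rewrite (Hw _ origin_in_disk) in Hg.
  destruct (reduce_word w) as (u & Hred & _ & Eu).
  rewrite (Eu _ origin_in_disk) in Hg; destruct u as [|i u].
  - simpl in Hg; pose proof (eucl_dist_sqr origin xi) as E.
    replace (sqdist origin xi) with (nrm2 xi) in E by (unfold sqdist, nrm2; simpl; ring).
    rewrite Hc in E; pose proof (eucl_dist_ge0 origin xi); nra.
  - pose proof (orbit_in_core i u Hred) as C; set (z := act (i :: u) origin) in *.
    rewrite eucl_dist_sym in Hg.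
    destruct (Nat.lt_ge_cases i N) as [Hi|Hi].
    + specialize (K i Hi); red in C.
      pose proof (eucl_dist_triangle xi (ctr i) z); lra.
    + pose proof (ball_near_accum i z (core_ball _ _ C)) as B.
      pose proof (half_pow_le N (S i) ltac:(lia)); unfold height in B.
      pose proof (eucl_dist_triangle xi accum z); lra.
Qed.

Lemma limit_set_refl i xi : limit_set Gamma xi -> limit_set Gamma (refl i xi).
Proof.
  intros [Hc Hlim]; split; [apply refl_circle, Hc|]; intros eps He.
  pose proof (circle_closed_disk _ Hc) as Hd; pose proof (rad_gt0 i).
  pose proof (ctr_dist_gt0 i xi Hd) as Hx; set (d := eucl_dist xi (ctr i)) in *.
  (* The first bound keeps the orbit point at distance at least [d / 2] from the centre; the second
     is then what [refl_dist] requires. *)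
  destruct (Hlim (Rmin (d / 2) (eps * d ^ 2 / (2 * rad i ^ 2)))) as (g & [w Hw] & Hg).
  { apply Rmin_glb_lt; [lra|]; apply Rdiv_lt_0_compat; [|nra].
    apply Rmult_lt_0_compat; [assumption | nra]. }
  exists (act (i :: w)); split; [exists (i :: w); intros x _; reflexivity|].
  rewrite (Hw _ origin_in_disk) in Hg.
  pose proof (act_closed_disk w _ (disk_closed_disk _ origin_in_disk)) as Hz.
  simpl act; set (z := act w origin) in *.
  rewrite refl_dist by assumption; fold d.
  pose proof (Rmin_l (d / 2) (eps * d ^ 2 / (2 * rad i ^ 2))) as M1.
  pose proof (Rmin_r (d / 2) (eps * d ^ 2 / (2 * rad i ^ 2))) as M2.
  assert (Dz : d / 2 <= eucl_dist z (ctr i)).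
  { pose proof (eucl_dist_triangle xi (ctr i) z); rewrite (eucl_dist_sym xi z) in *.
    unfold d in *; lra. }
  assert (Hlt : eucl_dist z xi < eps * d ^ 2 / (2 * rad i ^ 2)) by lra.
  apply <- Rlt_div_r in Hlt; [|nra].
  apply <- Rlt_div_l; [|nra].
  apply Rlt_le_trans with (eps * (d / 2 * d)); [lra|].
  apply Rmult_le_compat_l; [lra|]; apply Rmult_le_compat_r; lra.
Qed.

Lemma limit_set_act w xi : limit_set Gamma xi -> limit_set Gamma (act w xi).
Proof. intros H; induction w; simpl; [|apply limit_set_refl]; assumption. Qed.

Definition prefix (f : nat -> nat) (k : nat) : list nat := map f (seq 0 k).

Lemma prefix_S f k : prefix f (S k) = prefix f k ++ [f k].
Proof. unfold prefix; rewrite seq_S, map_app; reflexivity. Qed.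

Lemma act_rev_prefix f k z : act (rev (prefix f (S k))) z = refl (f k) (act (rev (prefix f k)) z).
Proof. rewrite prefix_S, rev_app_distr; reflexivity. Qed.

(** On the closed disk [act (rev w)] inverts [act w], so [f] lists the letters stripped from [xi]
    one after another. *)
Definition coded_by (f : nat -> nat) (xi : pt) : Prop :=
  forall k, in_core (f k) (act (rev (prefix f k)) xi).

Lemma limit_point_coding xi : limit_set Gamma xi ->
  (exists w, xi = act w accum) \/ (exists f, coded_by f xi).
Proof.
  intros Hlim; pose proof (circle_closed_disk _ (proj1 Hlim)) as Hd.
  destruct (classic (exists w, xi = act w accum)) as [|Hn]; [left; assumption | right].
  (* Off the cores the choice is arbitrary, but the path stays among limit points other than
     [accum], which lie in cores. *)
  pose (next := fun z => epsilon (inhabits 0%nat) (fun i => in_core i z)).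
  pose (path := fix path k := match k with
                              | O => xi
                              | S k => refl (next (path k)) (path k) end).
  assert (E : forall k, act (rev (prefix (fun k => next (path k)) k)) xi = path k).
  { induction k as [|k IH]; [reflexivity|].
    rewrite act_rev_prefix, IH; reflexivity. }
  exists (fun k => next (path k)); intros k.
  pose proof (limit_set_act (rev (prefix (fun k => next (path k)) k)) xi Hlim) as L.
  pose proof (limit_point_core _ L) as C; rewrite E in *.
  apply (epsilon_spec (inhabits 0%nat) (fun i => in_core i (path k))), C.
  intros A; apply Hn; exists (prefix (fun k => next (path k)) k).
  rewrite <- A, <- E; symmetry; apply act_rev_r, Hd.
Qed.

Lemma square_weight_app w w' :
  square_weight (w ++ w') = (square_weight w + square_weight w')%nat.
Proof. induction w; simpl; lia. Qed.

(** * Wall crossings of the ray to a coded point *)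

Lemma near_geodesic_act w a b z :
  in_closed_disk a -> in_closed_disk b -> in_closed_disk z ->
  near_geodesic a b z -> near_geodesic (act w a) (act w b) (act w z).
Proof.
  intros Ha Hb Hz H; induction w as [|i w IH]; [exact H|].
  apply near_geodesic_inversion; [apply rad_gt0 | apply ctr_orth | | | | exact IH];
    apply act_closed_disk; assumption.
Qed.

Lemma sqdist_continuous c (x y : R -> R) t :
  continuity_pt x t -> continuity_pt y t -> continuity_pt (fun u => sqdist (x u, y u) c) t.
Proof. intros; unfold sqdist; simpl fst; simpl snd; reg. Qed.

Lemma inversion_continuous c r (x y : R -> R) t : sqdist (x t, y t) c <> 0 ->
  continuity_pt x t -> continuity_pt y t ->
  continuity_pt (fun u => fst (inversion c r (x u, y u))) t /\
  continuity_pt (fun u => snd (inversion c r (x u, y u))) t.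
Proof. unfold inversion, sqdist; simpl fst; simpl snd; intros; split; reg. Qed.

Lemma act_continuous w (p : R -> pt) t : in_closed_disk (p t) ->
  continuity_pt (fun u => fst (p u)) t -> continuity_pt (fun u => snd (p u)) t ->
  continuity_pt (fun u => fst (act w (p u))) t /\
  continuity_pt (fun u => snd (act w (p u))) t.
Proof.
  intros Hp C1 C2; induction w as [|i w [IH1 IH2]]; [split; assumption|].
  apply (inversion_continuous (ctr i) (rad i)
           (fun u => fst (act w (p u))) (fun u => snd (act w (p u)))); [|assumption ..].
  apply Rgt_not_eq, (sqdist_center_gt0 _ _ (rad_gt0 i) (ctr_orth i) (act w (p t))).
  apply act_closed_disk, Hp.
Qed.

Lemma scal_nrm2 s z : nrm2 (scal s z) = s ^ 2 * nrm2 z.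
Proof. unfold nrm2, scal; simpl; ring. Qed.

Section Coding.

Variables (xi : pt) (f : nat -> nat).
Hypotheses (xi_circle : on_circle xi) (f_codes : coded_by f xi).

Lemma coding_neq k : f k <> f (S k).
Proof.
  intros E; pose proof (f_codes k) as C; pose proof (f_codes (S k)) as C'.
  rewrite act_rev_prefix, <- E in C'.
  apply core_refl_separated in C; [|apply act_closed_disk, circle_closed_disk, xi_circle].
  red in C'; pose proof (rad_gt0 (f k)); lra.
Qed.

Lemma prefix_reduced k : reduced (prefix f k).
Proof.
  unfold prefix; generalize 0%nat; induction k as [|k IH]; intros a; simpl; [exact I|].
  split; [|apply IH]; destruct k; simpl; [exact I | apply coding_neq].
Qed.

Lemma prefix_cyl k : cyl (prefix f k) xi.
Proof.
  destruct k as [|k]; [exact I|].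
  pose proof (circle_closed_disk _ xi_circle) as Hd.
  pose proof (prefix_reduced (S k)) as R; rewrite prefix_S in *.
  rewrite <- (act_rev_r (prefix f k) xi Hd).
  apply cyl_act; [exact R | apply act_closed_disk, Hd | apply core_ball, f_codes].
Qed.

(** After [k] letters are undone, the origin is outside the next ball while [xi] is in its core: the
    ray has to cross the wall. The induction is ping-pong with distinct consecutive letters. *)
Lemma prefix_origin_separated k :
  gap (f k) <= eucl_dist (act (rev (prefix f k)) origin) (ctr (f k)).
Proof.
  induction k as [|k IH]; [apply origin_separated|].
  apply (ball_separated _ (f k)); [apply not_eq_sym, coding_neq|].
  rewrite act_rev_prefix; apply core_ball, refl_in_core; [|exact IH].
  apply act_closed_disk, disk_closed_disk, origin_in_disk.
Qed.

Lemma square_weight_prefix k : (k <= square_weight (prefix f k))%nat.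
Proof.
  induction k as [|k IH]; [lia|].
  rewrite prefix_S, square_weight_app; simpl; lia.
Qed.

Lemma eucl_dist_scal s : s <= 1 -> eucl_dist (scal s xi) xi = 1 - s.
Proof.
  intros Hs; apply Rsqr_inj; [apply eucl_dist_ge0 | lra |].
  rewrite !Rsqr_pow2, eucl_dist_sqr.
  replace (sqdist _ _) with ((1 - s) ^ 2 * nrm2 xi)
    by (unfold sqdist, nrm2, scal; simpl; ring).
  rewrite xi_circle; ring.
Qed.

Lemma scal_in_disk s : 0 <= s < 1 -> in_disk (scal s xi).
Proof. intros H; red; rewrite scal_nrm2, xi_circle; nra. Qed.

Lemma ray_crosses_wall k : exists s, 0 < s < 1 /\
  eucl_dist (act (rev (prefix f k)) (scal s xi)) (ctr (f k)) = rad (f k).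
Proof.
  set (w := rev (prefix f k)); set (i := f k).
  pose (F := fun s => rad i ^ 2 - sqdist (act w (scal s xi)) (ctr i)).
  pose proof (rad_bounds i) as Hr; pose proof (gap_gt0 i).
  assert (F0 : F 0 < 0).
  { unfold F; replace (scal 0 xi) with origin by (unfold scal, origin; f_equal; ring).
    rewrite <- eucl_dist_sqr; pose proof (prefix_origin_separated k) as G.
    fold w i in G; nra. }
  assert (F1 : 0 < F 1).
  { unfold F; replace (scal 1 xi) with xi
      by (destruct xi; unfold scal; simpl; f_equal; ring).
    rewrite <- eucl_dist_sqr; pose proof (f_codes k) as G; red in G; fold w i in G.
    pose proof (eucl_dist_ge0 (act w xi) (ctr i)); nra. }
  destruct (IVT_interv F 0 1) as (s & Hs & Es); [|lra|assumption..|].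
  { intros a Ha; unfold F.
    apply (continuity_pt_minus (fun _ => rad i ^ 2)
             (fun s => sqdist (act w (scal s xi)) (ctr i)));
      [apply continuity_pt_const; intros u v; reflexivity|].
    destruct (act_continuous w (fun s => scal s xi) a) as [C1 C2].
    - red; rewrite scal_nrm2, xi_circle; nra.
    - unfold scal; simpl; reg.
    - unfold scal; simpl; reg.
    - exact (sqdist_continuous (ctr i) _ _ a C1 C2). }
  exists s; split.
  - split; apply Rnot_le_lt; intros K.
    + replace s with 0 in Es by lra; lra.
    + replace s with 1 in Es by lra; lra.
  - apply Rsqr_inj; [apply eucl_dist_ge0 | lra |].
    rewrite !Rsqr_pow2, eucl_dist_sqr; unfold F in Es; lra.
Qed.

Lemma near_geodesic_ray s : 0 <= s <= 1 -> near_geodesic origin xi (scal s xi).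
Proof.
  intros Hs; red; rewrite scal_nrm2.
  replace (sqdist (scal s xi) xi) with ((1 - s) ^ 2 * nrm2 xi)
    by (unfold sqdist, nrm2, scal; simpl; ring).
  replace (sqdist (scal s xi) origin) with (s ^ 2 * nrm2 xi)
    by (unfold sqdist, nrm2, scal; simpl; ring).
  replace (sqdist origin xi) with (nrm2 xi) by (unfold sqdist, nrm2; simpl; ring).
  rewrite xi_circle.
  replace (1 * (1 - s ^ 2 * 1) ^ 2) with ((1 - s) ^ 2 * (1 + s) ^ 2) by ring.
  rewrite !Rmult_1_r; apply Rmult_le_compat_l; nra.
Qed.

(** By invariance [near_geodesic] holds for the moved ray. The crossing is at distance at least
    [rad (f k)] from the image of the origin and [rad (f k) / 2] from that of [xi], and these images
    are at most 2 apart. *)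
Lemma crossing_depth k s : 0 < s < 1 ->
  let y := act (rev (prefix f k)) (scal s xi) in
  eucl_dist y (ctr (f k)) = rad (f k) -> rad (f k) ^ 2 / 4 <= 1 - nrm2 y.
Proof.
  intros Hs y Hy.
  pose proof (circle_closed_disk _ xi_circle) as Dx.
  pose proof (disk_closed_disk _ origin_in_disk) as D0.
  pose proof (scal_in_disk s ltac:(lra)) as Dz.
  pose proof (near_geodesic_act (rev (prefix f k)) _ _ _ D0 Dx (disk_closed_disk _ Dz)
                (near_geodesic_ray s ltac:(lra))) as N.
  pose proof (act_disk (rev (prefix f k)) _ Dz) as Dy.
  pose proof (act_closed_disk (rev (prefix f k)) _ Dx) as Db.
  pose proof (act_closed_disk (rev (prefix f k)) _ D0) as Da.
  pose proof (f_codes k) as Cb; pose proof (prefix_origin_separated k) as Ca.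
  fold y in N, Dy.
  set (a := act (rev (prefix f k)) origin) in *.
  set (b := act (rev (prefix f k)) xi) in *.
  set (i := f k) in *; pose proof (rad_bounds i) as Hr.
  red in Cb, Dy; unfold near_geodesic in N.
  assert (Ya : rad i <= eucl_dist y a).
  { pose proof (eucl_dist_triangle a (ctr i) y); rewrite (eucl_dist_sym a y) in *; lra. }
  assert (Yb : rad i / 2 <= eucl_dist y b).
  { pose proof (eucl_dist_triangle y (ctr i) b); lra. }
  assert (Hab : sqdist a b <= 4).
  { clear - Da Db; unfold in_closed_disk, nrm2, sqdist in *.
    destruct a as [a1 a2], b as [b1 b2]; simpl in *.
    pose proof (pow2_ge_0 (a1 + b1)); pose proof (pow2_ge_0 (a2 + b2)); nra. }
  rewrite <- (eucl_dist_sqr y a), <- (eucl_dist_sqr y b) in N.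
  assert (K : (rad i / 2) ^ 2 * rad i ^ 2 <= eucl_dist y b ^ 2 * eucl_dist y a ^ 2)
    by (apply Rmult_le_compat; try apply pow2_ge_0; apply pow_incr; lra).
  assert (M : sqdist a b * (1 - nrm2 y) ^ 2 <= 4 * (1 - nrm2 y) ^ 2)
    by (apply Rmult_le_compat_r; [apply pow2_ge_0 | exact Hab]).
  assert (rad i ^ 2 / 2 <= 2 * (1 - nrm2 y)); [|lra].
  apply Rsqr_incr_0_var; [|lra].
  unfold Rsqr; lra.
Qed.

(** The time is 2 artanh s. Its lower bound turns closeness to [xi] into lateness along the ray. *)
Lemma geod_ray_reparam s : 0 < s < 1 ->
  geod_ray xi (ln ((1 + s) / (1 - s))) = scal s xi /\ - ln (1 - s) <= ln ((1 + s) / (1 - s)).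
Proof.
  intros Hs; assert (Hq : 0 < (1 + s) / (1 - s)) by (apply Rdiv_lt_0_compat; lra).
  split.
  - unfold geod_ray; f_equal; set (L := ln _).
    assert (E : exp (L / 2) * exp (L / 2) = (1 + s) / (1 - s)).
    { rewrite <- exp_plus; replace (L / 2 + L / 2) with L by lra; apply exp_ln, Hq. }
    pose proof (exp_pos (L / 2)) as P; unfold tanh, sinh, cosh; rewrite exp_Ropp.
    set (e := exp (L / 2)) in *.
    apply Rmult_eq_reg_r with (e * e + 1); [|nra].
    transitivity (e * e - 1); [field; nra|].
    rewrite E; field; lra.
  - rewrite <- ln_Rinv by lra; apply ln_le; [apply Rinv_0_lt_compat; lra|].
    unfold Rdiv; rewrite <- (Rmult_1_l (/ (1 - s))) at 1.
    apply Rmult_le_compat_r; [left; apply Rinv_0_lt_compat|]; lra.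
Qed.

Lemma nonconical_coding : nonconical_limit_set Gamma xi ->
  forall N, exists k0, forall k, (k0 <= k)%nat -> (N <= f k)%nat.
Proof.
  intros [_ Hnc] N.
  (* By [crossing_depth], a crossing of a wall of index below [N] lies within this distance of the
     orbit of the origin. *)
  destruct (Hnc (arcosh (1 + 2 / (rad N ^ 2 / 4)))) as [T HT].
  destruct (pow_half_small (exp (- T)) (exp_pos _)) as [k0 Hk0].
  exists k0; intros k Hk; destruct (Nat.le_gt_cases N (f k)) as [|Hlt]; [assumption|exfalso].
  destruct (ray_crosses_wall k) as (s & Hs & Es).
  pose proof (crossing_depth k s Hs Es) as Hdepth.
  destruct (geod_ray_reparam s Hs) as [Er Hln].
  pose proof (circle_closed_disk _ xi_circle) as Dx.
  pose proof (scal_in_disk s ltac:(lra)) as Dz.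
  set (w := prefix f k) in *; set (y := act (rev w) (scal s xi)) in *.
  pose proof (act_disk (rev w) _ Dz) as Dy; fold y in Dy.
  assert (Ey : act w y = scal s xi) by apply act_rev_r, disk_closed_disk, Dz.
  (* The crossing shares its first [k + 1] letters with [xi], hence is close to [xi] and occurs
     after time [T]. *)
  assert (Cz : cyl (prefix f (S k)) (scal s xi)).
  { pose proof (prefix_reduced (S k)) as R; rewrite prefix_S in *; fold w in R |- *.
    rewrite <- Ey; apply cyl_act; [exact R | apply disk_closed_disk, Dy | red; lra]. }
  assert (Hclose : 1 - s <= (/ 2) ^ k0).
  { rewrite <- eucl_dist_scal by lra.
    eapply Rle_trans; [apply (cyl_dist (prefix f (S k)))|].
    - rewrite prefix_S; intros E; symmetry in E; exact (app_cons_not_nil _ _ _ E).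
    - apply prefix_reduced.
    - apply disk_closed_disk, Dz.
    - exact Dx.
    - exact Cz.
    - apply prefix_cyl.
    - apply half_pow_le; pose proof (square_weight_prefix (S k)); lia. }
  apply (HT (ln ((1 + s) / (1 - s)))) with (g := act w) (y := y).
  - apply Rle_trans with (- ln (1 - s)); [|exact Hln].
    rewrite <- (ln_exp T) at 1; rewrite <- ln_Rinv by lra; apply ln_le; [apply exp_pos|].
    rewrite <- (Rinv_inv (exp T)), <- exp_Ropp.
    apply Rinv_le_contravar; lra.
  - exists w; intros x _; reflexivity.
  - exact Dy.
  - apply hdist_origin_le; pose proof (rad_gt0 N); pose proof (rad_le (f k) N ltac:(lia)).
    split; [nra|]; apply Rle_trans with (2 := Hdepth); nra.
  - rewrite Er; exact Ey.
Qed.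

End Coding.

(** * Hausdorff dimension *)

(** An injective numbering of words, used to index covers. It grows exponentially in a quantity
    linear in the letters, whereas cylinders shrink with the squares of the letters. *)
Fixpoint code (w : list nat) : nat :=
  match w with
  | [] => 0
  | i :: w' => 2 ^ i * (2 * code w' + 1)
  end.

Fixpoint weight (w : list nat) : nat :=
  match w with
  | [] => 0
  | i :: w' => S i + weight w'
  end.

(** The head letter is the 2-adic valuation of the code, and the odd part determines the tail. *)
Lemma code_inj w w' : code w = code w' -> w = w'.
Proof.
  assert (P : forall i, (2 ^ i <> 0)%nat) by (intros i; apply Nat.pow_nonzero; lia).
  assert (K : forall i j a b, (2 ^ i * (2 * a + 1) = 2 ^ j * (2 * b + 1))%nat ->
                i = j /\ a = b).
  { induction i as [|i IH]; intros [|j] a b H; simpl in H; try lia.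
    destruct (IH j a b) as [-> ->]; [simpl; lia | split; reflexivity]. }
  revert w'; induction w as [|i w IH]; intros [|j w'] H; [reflexivity | | |];
    simpl in H; try (specialize (P i); nia); try (specialize (P j); nia).
  destruct (K i j (code w) (code w')) as [-> E]; [simpl; lia|].
  rewrite (IH w' E); reflexivity.
Qed.

Lemma code_le w : (code w + 1 <= 2 ^ weight w)%nat.
Proof.
  induction w as [|i w IH]; [simpl; lia|].
  change (code (i :: w)) with (2 ^ i * (2 * code w + 1))%nat.
  change (weight (i :: w)) with (S i + weight w)%nat.
  rewrite Nat.pow_add_r, Nat.pow_succ_r'.
  assert (2 ^ i <> 0)%nat by (apply Nat.pow_nonzero; lia); nia.
Qed.

(** With x = cos t the root is the chord 2 sin (t/2). For u = t/2 at most 2, the Taylor bound sin u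
    >= u - u^3/6 gives sin u >= u/3. *)
Lemma acos_le_chord x : -1 <= x <= 1 -> acos x <= 3 * sqrt (2 - 2 * x).
Proof.
  intros Hx; pose proof (acos_bound x) as B; set (t := acos x) in *.
  assert (Ex : x = cos t) by (symmetry; apply cos_acos; exact Hx).
  assert (E : 2 - 2 * x = (2 * sin (t / 2)) ^ 2).
  { replace t with (2 * (t / 2)) in Ex by lra; rewrite cos_2a_sin in Ex; rewrite Ex; ring. }
  pose proof PI_4 as P4.
  assert (S0 : 0 <= sin (t / 2)) by (apply sin_ge_0; lra).
  rewrite E, sqrt_pow2 by lra.
  assert (t / 2 / 3 <= sin (t / 2)); [|lra].
  destruct (pre_sin_bound (t / 2) 0) as [L _]; [lra|lra|].
  unfold sin_approx, sin_term in L; simpl in L.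
  replace (t / 2 / 3) with (t / 2 - t / 2 * (4 / 6)) by field.
  eapply Rle_trans; [|exact L].
  replace (_ + _) with (t / 2 - t / 2 * ((t / 2) ^ 2 / 6)) by (simpl; field).
  assert ((t / 2) ^ 2 <= 4) by nra; nra.
Qed.

Lemma ang_dist_le p q : on_circle p -> on_circle q -> ang_dist p q <= 3 * eucl_dist p q.
Proof.
  destruct p as [p1 p2], q as [q1 q2]; unfold on_circle, nrm2, ang_dist, eucl_dist.
  simpl fst; simpl snd; intros Hp Hq.
  replace ((p1 - q1) ^ 2 + (p2 - q2) ^ 2) with (2 - 2 * (p1 * q1 + p2 * q2)).
  - apply acos_le_chord.
    pose proof (pow2_ge_0 (p1 - q1)); pose proof (pow2_ge_0 (p2 - q2)).
    pose proof (pow2_ge_0 (p1 + q1)); pose proof (pow2_ge_0 (p2 + q2)); split; nra.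
  - replace 2 with (1 + 1) at 1 by ring; rewrite <- Hp at 1; rewrite <- Hq; ring.
Qed.

Lemma ang_diam_le U b : 0 <= b ->
  (forall p q, U p -> U q -> on_circle p -> on_circle q -> ang_dist p q <= b) ->
  ang_diam U <= b.
Proof.
  intros Hb H; unfold ang_diam.
  match goal with |- context [Lub_Rbar ?E] => pose proof (Lub_Rbar_correct E) as [_ L] end.
  (* Infinite suprema, such as that of the empty set, give [ang_diam] the value 0, which [Hb]
     covers. *)
  specialize (L (Finite b)); destruct (Lub_Rbar _) as [r| |]; [|lra|lra].
  apply L; intros d (p & q & Up & Uq & Cp & Cq & ->); apply H; assumption.
Qed.

Lemma rpow_ge0 d s : 0 <= rpow d s.
Proof. unfold rpow; destruct (Rle_dec d 0); [lra | left; apply exp_pos]. Qed.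

Lemma rpow_le d b s : 0 < s -> 0 < b -> d <= b -> rpow d s <= Rpower b s.
Proof.
  intros Hs Hb H; unfold rpow; destruct (Rle_dec d 0); [left; apply exp_pos|].
  apply Rle_Rpower_l; lra.
Qed.

Lemma is_series_telescope : is_series (fun n => / (INR n + 1) - / (INR n + 2)) 1.
Proof.
  assert (E : forall n, sum_n (fun n => / (INR n + 1) - / (INR n + 2)) n = 1 - / (INR n + 2)).
  { induction n as [|n IH]; [rewrite sum_O; simpl; field|].
    rewrite sum_Sn, IH, S_INR; unfold plus; simpl; pose proof (pos_INR n); field; lra. }
  change (is_lim_seq (sum_n (fun n => / (INR n + 1) - / (INR n + 2))) 1).
  apply (is_lim_seq_ext _ _ _ (fun n => eq_sym (E n))).
  replace (Finite 1) with (Rbar_minus 1 0) by (simpl; f_equal; ring).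
  apply is_lim_seq_minus'; [apply is_lim_seq_const|].
  replace (Finite 0) with (Rbar_inv p_infty) by reflexivity.
  apply is_lim_seq_inv; [|discriminate].
  apply is_lim_seq_plus with p_infty 2;
    [apply is_lim_seq_INR | apply is_lim_seq_const | reflexivity].
Qed.

Lemma hausdorff_delta_0 s delta A :
  (forall eps, 0 < eps -> exists U : nat -> pt -> Prop,
    (forall p, A p -> exists n, U n p) /\
    (forall n, ang_diam (U n) <= delta /\
               rpow (ang_diam (U n)) s <= eps * / (INR n + 1) ^ 2)) ->
  hausdorff_delta s delta A = Finite 0.
Proof.
  intros H; apply is_glb_Rbar_unique; split.
  - intros v (U & _ & _ & HU); rewrite <- (is_series_unique _ _ HU); simpl.
    rewrite <- (Rmult_0_l (Series (fun n => rpow (ang_diam (U n)) s))), <- Series_scal_l.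
    apply Series_le; [|exists v; exact HU].
    intros n; pose proof (rpow_ge0 (ang_diam (U n)) s); lra.
  - intros b Hb; apply Rbar_le_trans with (Finite 0); [|apply Rbar_le_refl].
    assert (K : forall eps, 0 < eps -> Rbar_le b eps).
    (* Halving [eps] pays for comparing the inverse squares with the telescoping series. *)
    { intros eps He; destruct (H (eps / 2)) as (U & Hcov & HU); [lra|].
      assert (B : forall n, 0 <= rpow (ang_diam (U n)) s <=
                 eps * (/ (INR n + 1) - / (INR n + 2))).
      { intros n; split; [apply rpow_ge0|].
        eapply Rle_trans; [apply HU|]; pose proof (pos_INR n).
        replace (/ (INR n + 1) - / (INR n + 2)) with (/ ((INR n + 1) * (INR n + 2)))
          by (field; lra).
        replace (eps / 2 * / (INR n + 1) ^ 2) with (eps * / (2 * (INR n + 1) ^ 2))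
          by (field; lra).
        apply Rmult_le_compat_l; [lra|]; apply Rinv_le_contravar; nra. }
      pose proof (is_series_scal_l eps _ _ is_series_telescope) as S.
      assert (X : ex_series (fun n => rpow (ang_diam (U n)) s)).
      { apply (ex_series_le (V := R_CompleteNormedModule)) with
          (b := fun n => eps * (/ (INR n + 1) - / (INR n + 2))); [|eexists; exact S].
        intros n; unfold norm; simpl; unfold abs; simpl.
        rewrite Rabs_pos_eq; apply B. }
      apply Rbar_le_trans with (Finite (Series (fun n => rpow (ang_diam (U n)) s))).
      - apply Hb; exists U; split; [exact Hcov|]; split; [apply HU | apply Series_correct, X].
      - simpl; apply Rle_trans with (Series (fun n => eps * (/ (INR n + 1) - / (INR n + 2)))).
        + apply Series_le; [exact B | eexists; exact S].
        + rewrite Series_scal_l, (is_series_unique _ _ is_series_telescope); lra. }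
    destruct b as [b| |]; simpl; [|exact (K 1 Rlt_0_1)|exact I].
    apply Rnot_lt_le; intros Hlt; specialize (K (b / 2) ltac:(lra)); simpl in K; lra.
Qed.

(* The third condition makes the cylinder small, the last one leaves the factor
   [4 ^ - weight w <= / (code w + 1) ^ 2] that makes the sum over all codes finite. *)
Definition thin (s M : R) (w : list nat) : Prop :=
  w <> [] /\ reduced w /\ M <= INR (square_weight w) /\
  M + 2 * INR (weight w) <= s * INR (square_weight w).

Lemma weight_app w w' : weight (w ++ w') = (weight w + weight w')%nat.
Proof. induction w; simpl; lia. Qed.

(** Once all letters are at least 3/s, each letter i adds s(i+1)^2 - 2(i+1) >= i+1 >= 1 to [F],
    which therefore exceeds any bound. *)
Lemma thin_prefix s M xi f : 0 < s -> on_circle xi -> coded_by f xi ->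
  (forall N, exists k0, forall k, (k0 <= k)%nat -> (N <= f k)%nat) ->
  exists k, thin s M (prefix f k).
Proof.
  intros Hs Hc Hf Hesc.
  destruct (INR_unbounded (3 / s)) as [N HN].
  assert (HN' : 3 <= s * INR N).
  { apply Rlt_le in HN; apply -> Rle_div_l in HN; lra. }
  destruct (Hesc N) as [k0 Hk0].
  pose (F := fun k => s * INR (square_weight (prefix f k)) - 2 * INR (weight (prefix f k))).
  assert (G : forall m, F k0 + INR m <= F (k0 + m)%nat).
  { induction m as [|m IH]; [rewrite Nat.add_0_r; simpl; lra|].
    rewrite Nat.add_succ_r, S_INR; unfold F in *.
    rewrite prefix_S, square_weight_app, weight_app.
    specialize (Hk0 (k0 + m)%nat ltac:(lia)); apply le_INR in Hk0.
    set (i := f (k0 + m)%nat) in *.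
    replace (square_weight [i]) with (S i * S i)%nat by (simpl; lia).
    replace (weight [i]) with (S i) by (simpl; lia).
    rewrite !plus_INR, mult_INR, S_INR; pose proof (pos_INR i).
    assert (3 <= s * INR i) by nra.
    assert (3 * (INR i + 1) <= s * ((INR i + 1) * (INR i + 1))) by nra.
    lra. }
  destruct (INR_unbounded (Rmax M (M - F k0))) as [m Hm].
  pose proof (Rmax_l M (M - F k0)); pose proof (Rmax_r M (M - F k0)).
  exists (k0 + S m)%nat; split; [|split; [|split]].
  - rewrite Nat.add_succ_r, prefix_S; intros E; symmetry in E.
    exact (app_cons_not_nil _ _ _ E).
  - exact (prefix_reduced xi f Hc Hf _).
  - pose proof (square_weight_prefix f (k0 + S m)) as W; apply le_INR in W.
    rewrite plus_INR, S_INR in W; pose proof (pos_INR k0); lra.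
  - specialize (G (S m)); rewrite S_INR in G; unfold F in *; lra.
Qed.

Lemma half_pow_Rpower n : (/ 2) ^ n = Rpower 2 (- INR n).
Proof. rewrite Rpower_Ropp, Rpower_pow, pow_inv by lra; reflexivity. Qed.

Lemma nonconical_null s : 0 < s -> hausdorff_null s (nonconical_limit_set Gamma).
Proof.
  intros Hs delta Hdelta; apply hausdorff_delta_0; intros eps Heps.
  (* [M1] makes the diameters small and [M2] their s-th powers. The 3 compares angle with chord; the
     4 is the square of the factor 2 that the head letter 0 adds to the bound on the code. *)
  destruct (pow_half_small (delta / 3)) as [M1 HM1]; [lra|].
  destruct (pow_half_small (eps / (4 * Rpower 3 s))) as [M2 HM2].
  { apply Rdiv_lt_0_compat; [lra|]; pose proof (exp_pos (s * ln 3)); unfold Rpower; lra. }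
  set (M := INR (M1 + M2)).
  (* The head letter distinguishes cylinders from single points of the orbit of [accum]. *)
  exists (fun n p => exists w,
    (n = code (0%nat :: w) /\ thin s M w /\ on_circle p /\ cyl w p) \/
    (n = code (1%nat :: w) /\ p = act w accum)).
  split.
  - intros xi Hxi; pose proof (proj1 Hxi) as Hlim.
    destruct (limit_point_coding xi Hlim) as [[w Ew] | [f Hf]].
    + exists (code (1%nat :: w)), w; right; split; [reflexivity | exact Ew].
    + pose proof (proj1 Hlim) as Hc.
      destruct (thin_prefix s M xi f Hs Hc Hf (nonconical_coding xi f Hc Hf Hxi)) as [k Hk].
      exists (code (0%nat :: prefix f k)), (prefix f k); left.
      split; [reflexivity|]; split; [exact Hk|]; split; [exact Hc|].
      exact (prefix_cyl xi f Hc Hf k).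
  - intros n; set (U := fun p => exists w, _).
    destruct (classic (exists w, n = code (0%nat :: w) /\ thin s M w)) as [(w & En & Hw) | Hno].
    + destruct Hw as (Hne & Hred & HM & HsM).
      assert (D : ang_diam U <= 3 * (/ 2) ^ square_weight w).
      { apply ang_diam_le; [pose proof (half_pow_bounds (square_weight w)); lra|].
        intros p q Hp Hq Cp Cq; eapply Rle_trans; [apply ang_dist_le; assumption|].
        assert (K : forall x, U x -> cyl w x).
        { intros x (v & [(E & _ & _ & C) | (E & _)]); rewrite En in E;
            apply code_inj in E; inversion E; subst; exact C. }
        apply Rmult_le_compat_l; [lra|].
        apply cyl_dist; try apply circle_closed_disk; auto. }
      split.
      * assert (HM' : (M1 <= square_weight w)%nat).
        { apply INR_le; eapply Rle_trans; [|exact HM]; apply le_INR; lia. }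
        pose proof (half_pow_le _ _ HM'); lra.
      * eapply Rle_trans; [apply (rpow_le _ _ s Hs) with (2 := D)|].
        { pose proof (half_pow_bounds (square_weight w)); lra. }
        rewrite <- Rpower_mult_distr by (try lra; apply half_pow_bounds).
        rewrite (half_pow_Rpower (square_weight w)), Rpower_mult.
        assert (P : Rpower 2 (- INR (square_weight w) * s) <= (/ 2) ^ (M2 + 2 * weight w)).
        { rewrite half_pow_Rpower; apply Rle_Rpower; [lra|].
          unfold M in HsM; rewrite plus_INR in HsM; rewrite plus_INR, mult_INR.
          pose proof (pos_INR M1); change (INR 2) with 2; lra. }
        assert (Q : (INR n + 1) ^ 2 <= 4 * 2 ^ (2 * weight w)).
        { pose proof (code_le (0%nat :: w)) as C; rewrite <- En in C; apply le_INR in C.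
          change (weight (0%nat :: w)) with (S (weight w)) in C.
          rewrite plus_INR, pow_INR in C; change (INR 2) with 2 in C; simpl in C.
          replace (4 * 2 ^ (2 * weight w)) with ((2 * 2 ^ weight w) ^ 2)
            by (rewrite (Nat.mul_comm 2), pow_mult; ring).
          pose proof (pos_INR n); apply pow_incr; lra. }
        pose proof (exp_pos (s * ln 3)) as E3; fold (Rpower 3 s) in E3.
        pose proof (pow_lt 2 (2 * weight w) ltac:(lra)) as E2.
        apply Rle_trans with (Rpower 3 s * (eps / (4 * Rpower 3 s) * / 2 ^ (2 * weight w))).
        { apply Rmult_le_compat_l; [lra|]; eapply Rle_trans; [exact P|].
          rewrite pow_add, <- (pow_inv 2); apply Rmult_le_compat_r; [|lra].
          left; apply pow_lt; lra. }
        replace (_ * _) with (eps * / (4 * 2 ^ (2 * weight w))) by (field; lra).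
        apply Rmult_le_compat_l; [lra|]; apply Rinv_le_contravar; [|exact Q].
        pose proof (pos_INR n); apply pow_lt; lra.
    (* Such an index names at most one point, in the orbit of [accum]. *)
    + assert (D : ang_diam U <= 0).
      { apply ang_diam_le; [lra|].
        intros p q (v & [(E & T & _) | (E & Ep)]) (v' & [(E' & T' & _) | (E' & Eq)]) Cp Cq;
          try (exfalso; apply Hno; eexists; split; eassumption).
        rewrite E in E'; apply code_inj in E'; inversion E'; subst v'.
        rewrite <- Ep in Eq; subst q; unfold ang_dist.
        replace (fst p * fst p + snd p * snd p) with (nrm2 p) by reflexivity.
        rewrite Cp, acos_1; lra. }
      split; [lra|]; unfold rpow; destruct (Rle_dec (ang_diam U) 0); [|contradiction].
      apply Rmult_le_pos; [lra|]; left; apply Rinv_0_lt_compat, pow_lt.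
      pose proof (pos_INR n); lra.
Qed.

Theorem theorem1p4 :
  exists G : (pt -> pt) -> Prop,
    discrete_subgroup G /\ infinitely_generated G /\
    hausdorff_dim (nonconical_limit_set G) = Finite 0.
Proof.
  exists Gamma; split; [exact Gamma_discrete|]; split; [exact Gamma_infinitely_generated|].
  apply is_glb_Rbar_unique; split.
  - intros s [Hs _]; left; exact Hs.
  - intros [b| |] Hb; simpl; [| |exact I].
    + apply Rnot_lt_le; intros Hlt.
      assert (K : b <= b / 2) by (apply (Hb (b / 2)); split; [|apply nonconical_null]; lra).
      lra.
    + exact (Hb 1 (conj Rlt_0_1 (nonconical_null 1 Rlt_0_1))).
Qed.
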